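(* Let $f\in\Gamma_0(X)$ with $Y\cap\operatorname{dom}f^*\neq\varnothing$ and let $(e,d)=(e_f,d_f)\in Y\times Y$ be the pair defined in the context. Then the following statements are equivalent for every $z\in X$: (i) $z=\operatorname{Prox}_f Rz$. (ii) $f^*(Sz)+f(z)+\frac12\|Sz\|^2=0$. (iii) $Sz=d$ and $f(z)=\mathrm{cl}(f\,\Box\,\iota_{Y^\perp})(e)$. (iv) $Sz=d$ and $f(z)=\mathrm{cl}(f\,\Box\,\iota_{Y^\perp})(z)$.
   Context: $X$ is a real Hilbert space with inner product $\langle\cdot,\cdot\rangle$ and norm $\|\cdot\|$. $m\in\{1,2,\dots\}$ and $R:X\to X$ is a linear isometry with $R^m=\mathrm{Id}$. $\operatorname{Fix}R=\{x: Rx=x\}$, $Y=(\operatorname{Fix}R)^\perp$ (so $Y^\perp=\operatorname{Fix}R$), $S=R-\mathrm{Id}$, $Q=\frac1m\sum_{i=1}^{m-1}iR^i$. $\Gamma_0(X)$ is the set of proper lower semicontinuous convex functions $X\to\,]-\infty,+\infty]$. $f^*(x^* )=\sup_{x\in X}(\langle x,x^*\rangle-f(x))$ is the Fenchel conjugate; $\operatorname{dom}f=\{f<+\infty\}$; $(f\,\Box\,g)(x)=\inf_{y\in X}(f(y)+g(x-y))$ is the infimal convolution; $\mathrm{cl}\,f$ is the lower semicontinuous convex hull of $f$ (largest lower semicontinuous convex function $\le f$); $\partial f$ is the convex subdifferential; $\operatorname{Prox}_f=(\mathrm{Id}+\partial f)^{-1}$ is the (single-valued) proximal mapping of $f\in\Gamma_0(X)$;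 $\iota_C$ is the indicator function ($0$ on $C$, $+\infty$ off $C$). The pair $(e_f,d_f)$: for $f\in\Gamma_0(X)$ with $Y\cap\operatorname{dom}f^*\ne\varnothing$, there is a unique pair $(e,d)\in Y\times Y$ such that $d=Se\in\operatorname{dom}f^*$, $e=Qd$, and $f^*(Se)+\langle y-Se,e\rangle-f^*(y)\le0$ for all $y\in Y$ (equivalently, $e\in\partial(f^*+\iota_Y)(Se)$); it is denoted $(e_f,d_f)$. *)

(* Defs.v *)
From HB Require Import structures.
From mathcomp Require Import all_boot all_order all_algebra.
From mathcomp Require Import all_classical all_reals all_analysis.

Set Implicit Arguments.
Unset Strict Implicit.
Unset Printing Implicit Defensive.

Import Order.TTheory GRing.Theory Num.Theory.
Import numFieldNormedType.Exports.

Local Open Scope classical_set_scope.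
Local Open Scope ring_scope.

(* A real Hilbert space is a complete normed module X over K : realType with a
   form ip : {dot X for idfun} (symmetric, bilinear and positive definite, as
   the conjugation is the identity) such that ip x x = `|x| ^+ 2. *)

Definition orthc (K : realType) (X : normedModType K) (ip : {dot X for idfun})
    (A : set X) : set X :=
  [set x | forall y, A y -> ip x y = 0].

Definition Fix (X : Type) (R : X -> X) : set X := [set x | R x = x].

Definition shiftS (K : realType) (X : normedModType K) (R : X -> X) (x : X) : X :=
  R x - x.

Definition meanQ (K : realType) (X : normedModType K) (m : nat) (R : X -> X)
    (x : X) : X :=
  m%:R^-1 *: \sum_(1 <= i < m) i%:R *: iter i R x.

Definition edom (K : realType) (X : Type) (f : X -> \bar K) : set X :=
  [set x | (f x < +oo)%E].

Definition epi (K : realType) (X : Type) (f : X -> \bar K) : set (X * K^o) :=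
  [set p | (f p.1 <= p.2%:E)%E].

(* Convexity of the epigraph makes sense for functions taking both infinite
   values, where the usual inequality may involve +oo - oo. *)
Definition econvex (K : realType) (X : normedModType K) (f : X -> \bar K) : Prop :=
  @convex_set K (X * K^o)%type (epi f).

Definition Gamma0 (K : realType) (X : normedModType K) (f : X -> \bar K) : Prop :=
  [/\ forall x, (-oo < f x)%E, edom f !=set0, lower_semicontinuous f & econvex f].

Definition conjugate (K : realType) (X : normedModType K)
    (ip : {dot X for idfun}) (f : X -> \bar K) (u : X) : \bar K :=
  ereal_sup (range (fun x => (ip x u)%:E - f x)%E).

Definition infconv (K : realType) (X : normedModType K) (f g : X -> \bar K)
    (x : X) : \bar K :=
  ereal_inf (range (fun y => f y + g (x - y)%R)%E).

Definition eindic (K : realType) (X : Type) (C : set X) (x : X) : \bar K :=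
  if x \in C then 0%E else +oo%E.

(* Suprema of lower semicontinuous convex functions are again such functions,
   so this is the largest one below f. *)
Definition lsc_hull (K : realType) (X : normedModType K) (f : X -> \bar K)
    (x : X) : \bar K :=
  ereal_sup [set h x | h in [set h : X -> \bar K |
    [/\ lower_semicontinuous h, econvex h & forall y, (h y <= f y)%E]]].

Definition subdiff (K : realType) (X : normedModType K)
    (ip : {dot X for idfun}) (f : X -> \bar K) (x : X) : set X :=
  [set u | forall y, (f x + (ip (y - x) u)%:E <= f y)%E].

(* (Id + subdiff f)^-1 as a set-valued operator; it is single-valued for f in
   Gamma0, so that p = Prox_f x reads Prox ip f x = [set p]. *)
Definition Prox (K : realType) (X : normedModType K)
    (ip : {dot X for idfun}) (f : X -> \bar K) (x : X) : set X :=
  [set p | exists2 u, subdiff ip f p u & x = p + u].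

(* The property that characterizes (e_f, d_f), with Y the orthogonal
   complement of Fix R. *)
Definition is_edpair (K : realType) (X : normedModType K)
    (ip : {dot X for idfun}) (m : nat) (R : X -> X) (f : X -> \bar K)
    (e d : X) : Prop :=
  let Y := orthc ip (Fix R) in
  let S := shiftS R in
  let fs := conjugate ip f in
  [/\ Y e /\ Y d, d = S e /\ edom fs d, e = meanQ m R d
    & forall y, Y y -> (fs (S e) + (ip (y - S e) e)%:E - fs y <= 0)%E].

(* Main.v *)
Require Import Defs.
From mathcomp Require Import all_boot all_order all_algebra.
From mathcomp Require Import all_classical all_reals all_analysis.
From mathcomp Require Import ring lra.
Import Order.TTheory GRing.Theory Num.Theory.
Import numFieldNormedType.Exports.
Local Open Scope classical_set_scope.
Local Open Scope ring_scope.

(** Write S = R - Id, let f* be the conjugate of f, and let g be the lower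
    semicontinuous convex hull of the infimal convolution of f with the
    indicator of Fix R. Two identities about S drive everything: since R is a
    linear isometry, <x, S x> = - |S x|^2 / 2 ([ip_shift]), and S x is
    orthogonal to Fix R ([orthc_shift]). The first one makes S strictly
    antimonotone modulo Fix R ([shift_antimonotone]) and shows that Fix R is
    its own double orthogonal ([orthc_orthc_Fix]).

    The equation z = Prox_f (R z) says that S z is a subgradient of f at z
    ([Prox_eq]). By the equality case of the Fenchel-Young inequality this
    means f z + f*(S z) = <z, S z>, and <z, S z> = - |S z|^2 / 2 turns that
    into f*(S z) + f z + |S z|^2 / 2 = 0.

    Assume this equation. Then z is a subgradient of f* at S z, whereas e is a
    subgradient at d = S e of the restriction of f* to Y = (Fix R)^perp. Adding
    the two subgradient inequalities gives <S z - S e, z - e> >= 0, so that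
    S z = d by antimonotonicity. The affine minorant of f with slope S z is
    exact at z; its slope lies in Y, so it is constant along Fix R and hence
    minorizes g as well ([hull_infconv_ge]). Therefore f z <= g z <= f z. Once
    S z = S e, the points z and e differ by an element of Fix R, along which g
    is constant, so that g z = g e and the last two statements agree.

    Conversely, if S z = d and f z = g z = g e, it remains to see that
    g e <= <e, d> - f*(d) ([hull_infconv_le_of_subgradient]), because the right
    hand side equals <z, S z> - f*(S z). This is where duality enters: by the
    Fenchel-Moreau theorem ([fenchel_moreau_minorant]) g e is the supremum of
    the values at e of the affine minorants of g. The slope v of such a
    minorant lies in Y, since g is constant along Fix R, and its value at e is
    at most <e, v> - f*(v), which the subgradient property of e bounds by
    <e, d> - f*(d). The Fenchel-Moreau theorem itself is proved by
    regularization: g plus a steep multiple of |. - e|^2 has a minimizer, by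
    completeness; there g has a subgradient, and the resulting affine minorant
    is high enough at e. *)

(** * Convex hulls and infimal convolutions of extended-valued functions *)

Section ExtendedFunctions.
Local Set Implicit Arguments.
Local Unset Strict Implicit.
Context (K : realType) (X : normedModType K).
Implicit Types (f g h : X -> \bar K).

(** Only real upper bounds of the values occur, which avoids the ill-defined
    sums of opposite infinities. *)
Lemma econvexP g : econvex g <->
  forall x y r s t, 0 <= t <= 1 -> (g x <= r%:E)%E -> (g y <= s%:E)%E ->
    (g (t *: x + (1 - t) *: y)%R <= (t * r + (1 - t) * s)%:E)%E.
Proof.
split=> [cvx x y r s t /andP[t0 t1] gx gy|cvx [x r] [y s] t].
  by have := cvx (x, r) (y, s) (Itv01 t0 t1); rewrite !inE /epi /=; apply.
by rewrite !inE /epi /=; apply: cvx; rewrite ge0 le1.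
Qed.

Lemma lsc_hull_le f x : (lsc_hull f x <= f x)%E.
Proof. by apply: ge_ereal_sup => _ [h [_ _ hf] <-]. Qed.

Lemma lsc_hull_max f h : lower_semicontinuous h -> econvex h ->
  (forall x, (h x <= f x)%E) -> forall x, (h x <= lsc_hull f x)%E.
Proof. by move=> lsch ch hf x; apply: ereal_sup_ubound; exists h. Qed.

Lemma lsc_hull_lsc f : lower_semicontinuous (lsc_hull f).
Proof.
move=> x a /ereal_sup_gt[_ [h [lsch ch hf] <-]] /lsch[V Vx Va].
exists V => // y /Va /lt_le_trans; apply; exact: lsc_hull_max.
Qed.

Lemma lsc_hull_convex f : econvex (lsc_hull f).
Proof.
apply/econvexP => x y r s t t01 fx fy.
apply: ge_ereal_sup => _ [h [lsch /[dup] ch /econvexP cvx hf] <-].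
by apply: cvx => //; [apply: le_trans fx|apply: le_trans fy]; exact: lsc_hull_max.
Qed.

Lemma lsc_translate f w : lower_semicontinuous f ->
  lower_semicontinuous (fun x => f (x + w)).
Proof.
move=> lscf x a /lscf[V Vx Va]; exists [set y | V (y + w)]; last first.
  by move=> y /Va.
have cw : (fun y => y + w) @ x --> x + w by apply: cvgD; [exact: cvg_id|exact: cvg_cst].
exact: cw.
Qed.

Lemma econvex_translate f w : econvex f -> econvex (fun x => f (x + w)).
Proof.
move=> /econvexP cvx; apply/econvexP => x y r s t t01 fx fy.
have -> : t *: x + (1 - t) *: y + w = t *: (x + w) + (1 - t) *: (y + w).
  by rewrite !scalerDr addrACA -scalerDl subrKC scale1r.
exact: cvx.
Qed.

(** The class of minorants defining the hull is stable under translation, so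
    the hull inherits the periods of the function. *)
Lemma lsc_hull_invariant f w : (forall x, f (x + w) = f x) ->
  forall x, lsc_hull f (x + w) = lsc_hull f x.
Proof.
have half v : (forall x, f (x + v) = f x) ->
    forall x, (lsc_hull f (x + v)%R <= lsc_hull f x)%E.
  move=> fv x; pose h y := lsc_hull f (y + v).
  rewrite -/(h x); apply: lsc_hull_max => [||y].
  - exact/lsc_translate/lsc_hull_lsc.
  - exact/econvex_translate/lsc_hull_convex.
  - by rewrite -fv; apply: lsc_hull_le.
move=> fw x; apply/eqP; rewrite eq_le half //=.
rewrite -{1}[x](addrK w); apply: half => y.
by rewrite -fw subrK.
Qed.

Lemma infconv_eindic_le f (V : set X) : V 0 ->
  forall x, (infconv f (eindic K V) x <= f x)%E.
Proof.
move=> V0 x; apply: ereal_inf_lbound; exists x => //.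
by rewrite subrr /eindic mem_set // adde0.
Qed.

Lemma infconv_eindic_invariant f (V : set X) w :
  (forall v, V (v + w) <-> V v) ->
  forall x, infconv f (eindic K V) (x + w) = infconv f (eindic K V) x.
Proof.
move=> Vw x; rewrite /infconv; under eq_fun => y.
  rewrite (_ : eindic K V (x + w - y) = eindic K V (x - y)); first over.
  by rewrite addrAC /eindic; congr (if _ then _ else _); apply/idP/idP; rewrite !inE Vw.
by [].
Qed.

(** A minorant of f that is constant along V survives the convolution with the
    indicator of V, because this convolution takes at x the infimum of f over
    x - V. *)
Lemma infconv_eindic_ge f (V : set X) h x : (forall y, (-oo < f y)%E) ->
  (forall y, (h y <= f y)%E) -> (forall v y, V v -> h (y + v) = h y) ->
  (h x <= infconv f (eindic K V) x)%E.
Proof.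
move=> fNy hf hV; apply: le_ereal_inf_tmp => _ [y _ <-].
rewrite /eindic; case: ifPn => [|_].
  by rewrite inE adde0 => /(hV _ y); rewrite addrC subrK => ->.
by rewrite addey ?leey // gt_eqF.
Qed.

End ExtendedFunctions.

(** * Conjugates, subgradients and proximal points *)

Section InnerProduct.
Local Set Implicit Arguments.
Local Unset Strict Implicit.
Context (K : realType) (X : normedModType K).
Context (ip : {dot X for idfun}) (norm_ip : forall x : X, ip x x = `|x| ^+ 2).
Implicit Types (x y z u v : X) (f g : X -> \bar K).

Lemma ipC x y : ip x y = ip y x.
Proof. by rewrite hermC expr0 mul1r. Qed.

Lemma ipZl a x y : ip (a *: x) y = a * ip x y.
Proof. by rewrite linearZl. Qed.

Lemma sqr_normD x y : `|x + y| ^+ 2 = `|x| ^+ 2 + 2 * ip x y + `|y| ^+ 2.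
Proof. by rewrite -!norm_ip linearDl !linearDr /= (ipC y x); ring. Qed.

Lemma sqr_normZ a x : `|a *: x| ^+ 2 = a ^+ 2 * `|x| ^+ 2.
Proof. by rewrite normrZ exprMn real_normK ?num_real. Qed.

(** The Cauchy-Schwarz inequality, from | |y| x + |x| y |^2 >= 0. *)
Lemma ip_ge x y : - (`|x| * `|y|) <= ip x y.
Proof.
have [->|y0] := eqVneq y 0; first by rewrite linear0r normr0 mulr0 oppr0.
have [->|x0] := eqVneq x 0; first by rewrite linear0l normr0 mul0r oppr0.
have px : 0 < `|x| by rewrite normr_gt0.
have py : 0 < `|y| by rewrite normr_gt0.
have := sqr_normD (`|y| *: x) (`|x| *: y).
rewrite !sqr_normZ ipZl (ipC x) ipZl (ipC y) => E.
have := sqr_ge0 `|(`|y| *: x + `|x| *: y)|; rewrite E => H.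
have : 0 <= (2 * (`|x| * `|y|)) * (`|x| * `|y| + ip x y) by lra.
by rewrite pmulr_rge0 ?mulr_gt0 //; lra.
Qed.

Lemma affine_lsc u b : lower_semicontinuous (fun x => (ip x u - b)%:E).
Proof.
move=> x a; rewrite lte_fin => ax.
have u1 : 0 < `|u| + 1 by have := normr_ge0 u; lra.
exists (ball x ((ip x u - b - a) / (`|u| + 1))).
  by apply: nbhsx_ballx; rewrite divr_gt0 //; lra.
move=> y; rewrite -ball_normE /= ltr_pdivlMr // => xy; rewrite lte_fin.
have := ip_ge (y - x) u; rewrite linearBl /= distrC => H.
by have := normr_ge0 (x - y); nra.
Qed.

Lemma affine_convex u b : econvex (fun x => (ip x u - b)%:E).
Proof.
apply/econvexP => x y r s t /andP[t0 t1]; rewrite !lee_fin => xr ys.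
rewrite linearDl /= !ipZl.
have : 0 <= t * (r - (ip x u - b)) by rewrite mulr_ge0 // subr_ge0.
have : 0 <= (1 - t) * (s - (ip y u - b)) by rewrite mulr_ge0 // subr_ge0.
by lra.
Qed.

Lemma subdiff_dom f p u : (exists x, f x < +oo)%E -> subdiff ip f p u ->
  (f p < +oo)%E.
Proof.
move=> [x fx] /(_ x); case: (f p) => [r| |] //; first by rewrite ltry.
by rewrite addye // leye_eq => /eqP fxy; rewrite fxy in fx.
Qed.

Lemma conjugateP f u b : (conjugate ip f u <= b%:E)%E <->
  forall x, ((ip x u - b)%:E <= f x)%E.
Proof.
have E x : ((ip x u)%:E - f x <= b%:E)%E = ((ip x u - b)%:E <= f x)%E.
  case: (f x) => [r| |]; rewrite ?leey ?leNye //=.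
  by rewrite -EFinB !lee_fin; apply/idP/idP; lra.
split=> [H x|H]; last by apply: ge_ereal_sup => _ [x _ <-]; rewrite E.
by rewrite -E; apply: le_trans H; apply: ereal_sup_ubound; exists x.
Qed.

Lemma conjugate_gtNy f u : (exists x, f x < +oo)%E -> (-oo < conjugate ip f u)%E.
Proof.
move=> [x fx]; apply: lt_le_trans (ereal_sup_ubound _); last by exists x.
by case: (f x) fx => // r _; rewrite ltNyr.
Qed.

(** The equality case of the Fenchel-Young inequality, in the form of the
    nontrivial inequality; [fenchel_young] is the other one. *)
Lemma subdiff_conjugate f p u r : f p = r%:E ->
  subdiff ip f p u <-> (conjugate ip f u <= (ip p u - r)%:E)%E.
Proof.
move=> fp; rewrite conjugateP /subdiff /= fp.
by split=> H x; move: (H x); rewrite linearBl /= -EFinD; congr (_%:E <= _)%E; ring.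
Qed.

Lemma fenchel_young f p u r : f p = r%:E ->
  ((ip p u - r)%:E <= conjugate ip f u)%E.
Proof.
by move=> fp; apply: ereal_sup_ubound; exists p => //; rewrite fp -EFinB.
Qed.

Lemma subdiff_monotone f p q u v : (exists x, f x < +oo)%E ->
  (forall x, -oo < f x)%E ->
  subdiff ip f p u -> subdiff ip f q v -> 0 <= ip (p - q) (u - v).
Proof.
move=> fdom fNy pu qv; have fp := subdiff_dom fdom pu.
have fq := subdiff_dom fdom qv; move: (pu q) (qv p) (fNy p) (fNy q) fp fq.
case: (f p) => // r; case: (f q) => // s; rewrite -!EFinD !lee_fin => + + _ _ _ _.
by rewrite !linearBl !linearBr /=; lra.
Qed.

(** Monotonicity of the subdifferential makes the resolvent at most single
    valued: two values p and q would satisfy - |p - q|^2 >= 0. *)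
Lemma Prox_eq f x p : (exists x, f x < +oo)%E -> (forall x, -oo < f x)%E ->
  Prox ip f x = [set p] <-> subdiff ip f p (x - p).
Proof.
move=> fdom fNy; split=> [E|pu].
  have : Prox ip f x p by rewrite E.
  by move=> [u pu ->]; rewrite addrC addKr.
apply/seteqP; split=> [q [v qv xE]|_ ->]; last by exists (x - p) => //; rewrite subrKC.
have := subdiff_monotone fdom fNy pu qv.
rewrite xE [q + v - p - v]addrAC addrK -[q - p]opprB linearNr /= norm_ip oppr_ge0 => H.
apply/esym/eqP; rewrite -subr_eq0 -normr_eq0 -sqrf_eq0 eq_le H.
by rewrite sqr_ge0.
Qed.

End InnerProduct.

(** * The Fenchel-Moreau theorem in a Hilbert space *)

Section FenchelMoreau.
Local Set Implicit Arguments.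
Local Unset Strict Implicit.
Context (K : realType) (X : completeNormedModType K).
Context (ip : {dot X for idfun}) (norm_ip : forall x : X, ip x x = `|x| ^+ 2).
Implicit Types (x y z u v c e p : X) (g : X -> \bar K).

(** Lower semicontinuity keeps g above t on a ball around e; outside the ball
    a steep enough parabola is below the affine minorant. *)
Lemma quadratic_minorant g u b e t : lower_semicontinuous g ->
  (forall x, (ip x u - b)%:E <= g x)%E -> (t%:E < g e)%E ->
  exists2 lam, 0 < lam & forall x, ((t - lam * `|x - e| ^+ 2)%:E <= g x)%E.
Proof.
move=> lscg gub /lscg[V /nbhs_ballP[del /= del0 delV] Vt].
(* By |x - e + u|^2 >= 0 the affine minorant is at least
   ip e u - b - |u|^2 / 2 - |x - e|^2 / 2: this accounts for the 1/2 in the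
   coefficient, and k is the gap left to fill at distance at least del. *)
pose k := t - (ip e u - b) + `|u| ^+ 2 / 2.
have k0 : 0 <= `|k| / del ^+ 2 by rewrite divr_ge0 // exprn_ge0 // ltW.
exists (1 / 2 + `|k| / del ^+ 2); first by lra.
move=> x; have [xe|xe] := ltP `|x - e| del.
  have /delV/Vt/ltW : ball e del x by rewrite -ball_normE /= distrC.
  apply: le_trans; rewrite lee_fin lerBlDr lerDl mulr_ge0 ?exprn_ge0 //; lra.
apply: le_trans (gub x); rewrite lee_fin.
have kx : `|k| <= `|k| / del ^+ 2 * `|x - e| ^+ 2.
  rewrite mulrAC ler_pdivlMr ?exprn_gt0 // ler_wpM2l //.
  by rewrite lerXn2r ?nnegrE // ltW.
have := sqr_normD norm_ip (x - e) u; rewrite linearBl /= => sq.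
have := sqr_ge0 `|x - e + u|; have := ler_norm k; rewrite sq {1}/k.
by lra.
Qed.

(** A minimizing sequence is Cauchy: by the parallelogram identity the square
    of the distance between two almost minimizers is controlled by how much
    the objective at their midpoint falls short of the average of its values.
    Completeness gives a limit, and lower semicontinuity makes it a minimizer. *)
Lemma quadratic_argmin g c lam b : 0 < lam -> lower_semicontinuous g ->
  econvex g -> (exists x, g x < +oo)%E ->
  (forall x, (b - lam * `|x - c| ^+ 2)%:E <= g x)%E ->
  exists p r, g p = r%:E /\
    forall x, ((r + lam * `|p - c| ^+ 2 - lam * `|x - c| ^+ 2)%:E <= g x)%E.
Proof.
move=> lam0 lscg /econvexP cvx gdom gb.
pose A := [set s : K | exists x, (g x <= (s - lam * `|x - c| ^+ 2)%:E)%E].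
have infA : has_inf A.
  split; last first.
    by exists b => s [x gx]; have := le_trans (gb x) gx; rewrite lee_fin; lra.
  have [x gx] := gdom; have := gb x; move: gx.
  case Ex : (g x) => [s| |] // _ _; exists (s + lam * `|x - c| ^+ 2), x.
  by rewrite addrK Ex.
pose mu := inf A.
(* The infimum mu runs over the real upper bounds of the values of the
   objective, that is, over the heights of its epigraph. *)
have mule x : ((mu - lam * `|x - c| ^+ 2)%:E <= g x)%E.
  case Ex : (g x) => [s| |]; rewrite ?leey //; last by have := gb x; rewrite Ex.
  rewrite lee_fin lerBlDr; apply: ge_inf; first by case: infA.
  by exists x; rewrite Ex addrK.
have /choice[xn xnP] : forall n : nat, exists x,
    (g x <= (mu + n.+1%:R^-1 - lam * `|x - c| ^+ 2)%:E)%E.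
  move=> n; have [|s [x gx] sn] := @inf_adherent _ A n.+1%:R^-1 _ infA.
    by rewrite invr_gt0.
  by exists x; apply: le_trans gx _; rewrite lee_fin lerD2r ltW.
have close m n : lam * `|xn m - xn n| ^+ 2 <= 2 * (m.+1%:R^-1 + n.+1%:R^-1).
  have h01 : 0 <= (1 / 2 : K) <= 1 by lra.
  have := le_trans (mule _) (cvx _ _ _ _ _ h01 (xnP m) (xnP n)).
  have -> : 1 / 2 *: xn m + (1 - 1 / 2) *: xn n - c =
            (1 / 2) *: ((xn m - c) + (xn n - c)).
    rewrite (_ : 1 - 1 / 2 = 1 / 2 :> K); last by lra.
    rewrite -scalerDr addrACA -opprD scalerBr; congr (_ - _).
    by rewrite scalerDr -scalerDl -splitr scale1r.
  have -> : xn m - xn n = (xn m - c) + (-1) *: (xn n - c).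
    by rewrite scaleN1r opprB subrKA.
  move: (xn m - c) (xn n - c) => y z; rewrite lee_fin sqr_normZ !(sqr_normD norm_ip).
  rewrite sqr_normZ (ipC ip y (-1 *: z)) ipZl (ipC ip z y).
  by move: (m.+1%:R^-1) (n.+1%:R^-1) => a a1; lra.
have cxn : cvgn xn.
  apply/cauchy_cvgP/cauchy_exP => eps eps0.
  have d0 : 0 < lam * eps ^+ 2 / 4 by rewrite divr_gt0 // mulr_gt0 // exprn_gt0.
  have [N _ NP] := near_infty_natSinv_lt (PosNum d0).
  exists (xn N); exists N => // n /= Nn; rewrite -ball_normE /=.
  rewrite -(ltr_pXn2r (ltn0Sn 1)) ?nnegrE ?(ltW eps0) // -(ltr_pM2l lam0).
  have := close N n; have := NP _ (leqnn N); have := NP _ Nn => /=.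
  by move: (n.+1%:R^-1) (N.+1%:R^-1) => s s1; lra.
have [p xp] : exists p, xn @ \oo --> p by exists (limn xn); exact: cxn.
have gp : g p = (mu - lam * `|p - c| ^+ 2)%:E.
  apply/eqP; rewrite eq_le mule andbT.
  apply/lee_addgt0Pr => eps eps0; rewrite leNgt; apply/negP.
  rewrite -EFinD => /lscg[V Vp Vg].
  have cvn : lam * `|xn n - c| ^+ 2 @[n --> \oo] --> lam * `|p - c| ^+ 2.
    apply: cvgM; first exact: cvg_cst.
    apply: (cvg_comp _ (fun z : K => z ^+ 2)); last exact: exprn_continuous.
    by apply: cvg_norm; apply: cvgB => //; exact: cvg_cst.
  have e2 : 0 < eps / 2 by lra.
  have [n [nV nc ne]] : exists n, [/\ V (xn n),
      lam * `|p - c| ^+ 2 - eps / 2 < lam * `|xn n - c| ^+ 2 &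
      n.+1%:R^-1 < eps / 2].
    near \oo => n; exists n; split; near: n.
    - exact: xp.
    - by apply: (cvgr_gt _ cvn); lra.
    - exact: (near_infty_natSinv_lt (PosNum e2)).
  have := lt_le_trans (Vg _ nV) (xnP n); rewrite lte_fin.
  by move: (n.+1%:R^-1) ne => s; lra.
exists p, (mu - lam * `|p - c| ^+ 2); split=> // x.
by rewrite subrK.
Unshelve. all: by end_near. Qed.

(** The limit t -> 0, taken by evaluating at t = a / (2 b). *)
Lemma le0_of_le_small (a b : K) :
  (forall t, 0 < t <= 1 -> a <= t * b) -> a <= 0.
Proof.
move=> ab; rewrite leNgt; apply/negP => a0.
have := ab 1; rewrite ltr01 lexx mul1r => /(_ isT) leab.
have b0 : 0 < b by exact: lt_le_trans leab.
have := ab (a / (2 * b)); rewrite divr_gt0 ?mulr_gt0 //= ler_pdivrMr ?mulr_gt0 //.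
have -> : a / (2 * b) * b = a / 2 by field; rewrite gt_eqF.
by move=> H; suff /H : a <= 1 * (2 * b); lra.
Qed.

(** First order optimality: compare the minimizer p with p + t (x - p) and let
    t tend to 0. The negative gradient of the quadratic term at p is then a
    subgradient of g at p. *)
Lemma quadratic_argmin_minorant g c lam p r : econvex g -> g p = r%:E ->
  (forall x, (r + lam * `|p - c| ^+ 2 - lam * `|x - c| ^+ 2)%:E <= g x)%E ->
  forall x, ((r + 2 * lam * ip (x - p) (c - p))%:E <= g x)%E.
Proof.
move=> /econvexP cvx gp pmin x.
case Ex : (g x) => [s| |]; rewrite ?leey //; last by have := pmin x; rewrite Ex.
rewrite lee_fin -subr_le0.
apply: (@le0_of_le_small _ (lam * `|x - p| ^+ 2)) => t /andP[t0 t1].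
have t01 : 0 <= t <= 1 by rewrite ltW.
have gxs : (g x <= s%:E)%E by rewrite Ex.
have gpr : (g p <= r%:E)%E by rewrite gp.
have := le_trans (pmin _) (cvx _ _ _ _ _ t01 gxs gpr).
have -> : t *: x + (1 - t) *: p - c = t *: (x - p) + (-1) *: (c - p).
  by rewrite scaleN1r opprB scalerBr scalerBl scale1r [t *: x + _]addrCA [p + _]addrC -addrA.
rewrite -[p - c]opprB normrN lee_fin; move: (x - p) (c - p) => y z.
rewrite (sqr_normD norm_ip) !sqr_normZ ipZl (ipC ip y (-1 *: z)) ipZl (ipC ip z) => H.
rewrite -(ler_pM2l t0); lra.
Qed.

(** A proper lower semicontinuous convex function with an affine minorant is
    the supremum of its affine minorants. At the minimizer p of
    g + lam |. - e|^2 the supporting affine function takes at e the value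
    g p + 2 lam |p - e|^2, which is at least the minimum, itself at least t. *)
Lemma fenchel_moreau_minorant g u b e t : lower_semicontinuous g -> econvex g ->
  (exists x, g x < +oo)%E -> (forall x, (ip x u - b)%:E <= g x)%E ->
  (t%:E < g e)%E ->
  exists v a, (forall x, (ip x v - a)%:E <= g x)%E /\ t <= ip e v - a.
Proof.
move=> lscg cvx gdom gub te.
have [lam lam0 gt] := quadratic_minorant lscg gub te.
have [p [r [gp pmin]]] := quadratic_argmin lam0 lscg cvx gdom gt.
have gmin := quadratic_argmin_minorant cvx gp pmin.
exists ((2 * lam) *: (e - p)), (ip p ((2 * lam) *: (e - p)) - r).
have E x : ip x ((2 * lam) *: (e - p)) - (ip p ((2 * lam) *: (e - p)) - r) =
    r + 2 * lam * ip (x - p) (e - p).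
  by rewrite !(ipC ip _ (_ *: _)) !ipZl !(ipC ip (e - p)) linearBl /=; ring.
split=> [x|]; rewrite E //.
have := gt p; rewrite gp lee_fin norm_ip [`|p - e|]distrC => tr.
have : 0 <= lam * `|e - p| ^+ 2 by rewrite mulr_ge0 ?exprn_ge0 // ltW.
by lra.
Qed.

End FenchelMoreau.

(** * The displacement of a linear isometry *)

Section LinearIsometry.
Local Set Implicit Arguments.
Local Unset Strict Implicit.
Context (K : realType) (X : normedModType K).
Context (ip : {dot X for idfun}) (norm_ip : forall x : X, ip x x = `|x| ^+ 2).
Context (R : {linear X -> X}) (R_isometry : forall x : X, `|R x| = `|x|).
Implicit Types (x y z w u : X).

Lemma isometry_ip x y : ip (R x) (R y) = ip x y.
Proof.
have := sqr_normD norm_ip (R x) (R y).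
by rewrite -linearD /= !R_isometry (sqr_normD norm_ip); lra.
Qed.

Lemma shiftB x y : shiftS R (x - y) = shiftS R x - shiftS R y.
Proof.
rewrite /shiftS linearB /= !opprB addrC [y - x]addrC addrACA.
by rewrite [- x + R x]addrC.
Qed.

(** This is |x + S x|^2 = |x|^2 expanded, as x + S x = R x. *)
Lemma ip_shift x : ip x (shiftS R x) = - (2^-1 * `|shiftS R x| ^+ 2).
Proof.
have := R_isometry x; rewrite -[R x](subrKC x) -/(shiftS R x) => E.
by have := sqr_normD norm_ip x (shiftS R x); rewrite E; lra.
Qed.

Lemma orthc_shift x : orthc ip (Fix R) (shiftS R x).
Proof. by move=> w /= Rw; rewrite linearBl /= -{1}Rw isometry_ip subrr. Qed.

(** If x is orthogonal to the orthogonal complement of Fix R, it is orthogonal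
    to S x, and [ip_shift] gives S x = 0. *)
Lemma orthc_orthc_Fix : orthc ip (orthc ip (Fix R)) = Fix R.
Proof.
apply/seteqP; split=> [x xYY|x xF y yY]; last by rewrite ipC; exact: yY.
apply/eqP; rewrite -subr_eq0 -normr_eq0 -sqrf_eq0.
by have := ip_shift x; rewrite xYY ?/shiftS; [lra|exact: orthc_shift].
Qed.

Lemma shift_antimonotone x y : 0 <= ip (shiftS R x - shiftS R y) (x - y) ->
  shiftS R x = shiftS R y.
Proof.
rewrite -shiftB ipC ip_shift oppr_ge0 => H; apply/eqP.
by rewrite -subr_eq0 -shiftB -normr_eq0 -sqrf_eq0; have := sqr_ge0 `|shiftS R (x - y)|; lra.
Qed.

End LinearIsometry.

(** * Convolution with the indicator of a subspace *)

Section HullOfInfconv.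
Local Set Implicit Arguments.
Local Unset Strict Implicit.
Context (K : realType) (X : completeNormedModType K).
Context (ip : {dot X for idfun}) (norm_ip : forall x : X, ip x x = `|x| ^+ 2).
Context (V : set X) (V0 : V 0) (VD : forall v w, V w -> V (v + w) <-> V v)
  (VZ : forall (a : K) w, V w -> V (a *: w)).
Context (f : X -> \bar K) (fNy : forall x, (-oo < f x)%E).
Context (f_dom : exists x, (f x < +oo)%E).
Implicit Types (x y z u v w e d : X).

Let g := lsc_hull (infconv f (eindic K V)).

Lemma hull_infconv_le x : (g x <= f x)%E.
Proof. by apply: le_trans (infconv_eindic_le f V0 x); exact: lsc_hull_le. Qed.

Lemma hull_infconv_invariant x w : V w -> g (x + w) = g x.
Proof.
by move=> Vw; apply: lsc_hull_invariant => y; apply: infconv_eindic_invariant => v; exact: VD.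
Qed.

(** The affine minorant of f with slope u is constant along V, so it passes to
    the convolution by [infconv_eindic_ge], and to its hull. *)
Lemma hull_infconv_ge u b x : orthc ip V u -> (conjugate ip f u <= b%:E)%E ->
  ((ip x u - b)%:E <= g x)%E.
Proof.
move=> uV /conjugateP fub.
apply: (lsc_hull_max (h := fun y => (ip y u - b)%:E)) => [||y].
- exact: affine_lsc.
- exact: affine_convex.
apply: (infconv_eindic_ge (h := fun y => (ip y u - b)%:E)) => // v z Vv.
by rewrite linearDl /= (ipC ip v) uV // addr0.
Qed.

(** An affine function below g is bounded above along x + V, where g is
    constant, and therefore constant there. *)
Lemma affine_below_hull_infconv u b : (forall x, (ip x u - b)%:E <= g x)%E ->
  orthc ip V u /\ (conjugate ip f u <= b%:E)%E.
Proof.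
move=> gub; split; last first.
  by apply/conjugateP => x; apply: le_trans (hull_infconv_le x).
move=> w Vw; rewrite ipC; apply/eqP; apply: contraT => wu0.
have [x fx] := f_dom.
pose r := fine (f x).
have fxr : f x = r%:E by rewrite fineK // fin_numE gt_eqF //= lt_eqF.
(* The multiple of w at which the affine function would take the value r + 1. *)
pose a := (r + 1 - (ip x u - b)) / ip w u.
have := gub (x + a *: w); rewrite hull_infconv_invariant; last exact: VZ.
move=> /le_trans/(_ (hull_infconv_le x)).
rewrite fxr lee_fin linearDl /= ipZl mulfVK //; lra.
Qed.

(** The hypothesis says that e is a subgradient at d of the conjugate restricted
    to the orthogonal of V. That restriction is the conjugate of the infimal
    convolution, so this is the Fenchel-Young equality for its biconjugate, and
    the Fenchel-Moreau theorem puts g below the biconjugate. *)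
Lemma hull_infconv_le_of_subgradient e d q : conjugate ip f d = q%:E ->
  orthc ip V d ->
  (forall y, orthc ip V y -> (q%:E + (ip (y - d) e)%:E - conjugate ip f y <= 0)%E) ->
  (g e <= (ip e d - q)%:E)%E.
Proof.
move=> fd dV ed.
have gdom : (exists x, g x < +oo)%E.
  by have [x fx] := f_dom; exists x; apply: le_lt_trans (hull_infconv_le x) fx.
have gub x : ((ip x d - q)%:E <= g x)%E by apply: hull_infconv_ge; rewrite ?fd.
have below t : (t%:E < g e)%E -> t <= ip e d - q.
  move=> te; have [v [a [gva /le_trans]]] := fenchel_moreau_minorant norm_ip
    (@lsc_hull_lsc _ _ _) (@lsc_hull_convex _ _ _) gdom gub te.
  apply; have [vV] := affine_below_hull_infconv gva.
  have := ed v vV; have := conjugate_gtNy ip v f_dom.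
  case: (conjugate ip f v) => // s _.
  by rewrite -!EFinD !lee_fin linearBl /= !(ipC ip _ e); lra.
rewrite leNgt; apply/negP; case E : (g e) => [s| |] // lt.
  by have := below ((ip e d - q + s) / 2); rewrite E !lte_fin in lt *; lra.
by have := below (ip e d - q + 1); rewrite E ltry => /(_ isT); lra.
Qed.

End HullOfInfconv.

(** * Fixed points of the proximal mapping composed with an isometry *)

Theorem theorem4p6 (K : realType) (X : completeNormedModType K)
    (ip : {dot X for idfun}) (norm_ip : forall x : X, ip x x = `|x| ^+ 2)
    (m : nat) (m_gt0 : (0 < m)%N)
    (R : {linear X -> X}) (R_isometry : forall x : X, `|R x| = `|x|)
    (R_order : forall x : X, iter m R x = x)
    (f : X -> \bar K) (f_Gamma0 : Gamma0 f)
    (Y_domfs : orthc ip (Fix R) `&` edom (conjugate ip f) !=set0)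
    (e d : X) (ed_f : is_edpair ip m R f e d) :
  let Y := orthc ip (Fix R) in
  let S := shiftS R in
  let fs := conjugate ip f in
  let g := lsc_hull (infconv f (eindic K (orthc ip Y))) in
  forall z : X,
    [<-> Prox ip f (R z) = [set z];
         (fs (S z) + f z + (2^-1 * `|S z| ^+ 2)%:E = 0)%E;
         S z = d /\ f z = g e;
         S z = d /\ f z = g z].
Proof.
move=> Y S fs g z.
have YF : orthc ip Y = Fix R by exact: orthc_orthc_Fix.
have [fNy f_dom _ _] := f_Gamma0.
have [_ [dSe fsd_dom] _ ed] := ed_f.
change (d = S e) in dSe.
have YS x : Y (S x) by exact: orthc_shift.
have [q fsd] : exists q, fs d = q%:E.
  move: fsd_dom (conjugate_gtNy ip d f_dom); rewrite /edom /= /fs.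
  by case: (conjugate ip f d) => // q _ _; exists q.
have {}ed y : Y y -> (q%:E + (ip (y - d) e)%:E - fs y <= 0)%E.
  by move=> /ed; rewrite -fsd dSe.
have F0 : Fix R 0 by rewrite /Fix /= linear0.
have FD v w : Fix R w -> Fix R (v + w) <-> Fix R v.
  rewrite /Fix /= => Rw; rewrite linearD /= Rw.
  by split=> [/addIr|->].
have FZ (a : K) w : Fix R w -> Fix R (a *: w).
  by rewrite /Fix /= linearZ /= => ->.
rewrite /g YF {g}; set g := lsc_hull _.
have gze : S z = d -> g z = g e.
  move=> Szd; rewrite -[z](subrK e) addrC; apply: hull_infconv_invariant => //.
  by apply/eqP; rewrite -subr_eq0 -/(shiftS R (z - e)) shiftB -/S Szd -dSe subrr.
tfae.
- move=> /(Prox_eq norm_ip (R z) z f_dom fNy) => zS.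
  have fz := subdiff_dom f_dom zS.
  have [r fzr] : exists r, f z = r%:E.
    by move: fz (fNy z); case: (f z) => // r _ _; exists r.
  have : fs (S z) = (ip z (S z) - r)%:E.
    apply/eqP; rewrite eq_le (fenchel_young ip (S z) fzr) andbT.
    exact/(subdiff_conjugate ip (S z) fzr).
  by move=> ->; rewrite fzr -!EFinD ip_shift //; congr (_%:E); lra.
- have := fNy z; have := conjugate_gtNy ip (S z) f_dom; rewrite -/(fs _).
  case Es : (fs (S z)) => [s| |] // _; case Er : (f z) => [r| |] // _.
  rewrite -!EFinD => -[srz].
  have ipz := ip_shift norm_ip R_isometry z; rewrite -/(S z) in ipz.
  have Szd : S z = d.
    (* Sum of the subgradient inequalities of f* at S z and of its restriction
       to Y at d. *)
    rewrite dSe; apply: (shift_antimonotone norm_ip R_isometry).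
    have := ed _ (YS z); rewrite Es -!EFinD lee_fin.
    have := fenchel_young ip d Er; rewrite -/(fs d) fsd lee_fin -/S -dSe.
    move: (S z) srz ipz => u srz ipz.
    by rewrite !linearBl !linearBr /= (ipC ip d z) (ipC ip u z); lra.
  split=> //; rewrite -gze //; apply/eqP; rewrite eq_le; apply/andP; split; last first.
    by rewrite -Er; exact: hull_infconv_le.
  (* The affine minorant of slope S z is exact at z. *)
  have <- : ip z (S z) - s = r by lra.
  by apply: hull_infconv_ge => //; [exact: YS|rewrite -/(fs (S z)) Es].
- by move=> [Szd ->]; rewrite gze.
- move=> [Szd fzg]; apply/(Prox_eq norm_ip (R z) z f_dom fNy).
  have gq : (g e <= (ip e d - q)%:E)%E.
    by apply: hull_infconv_le_of_subgradient => //; rewrite dSe; exact: YS.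
  move: fzg; rewrite gze //; move=> fzg; rewrite -fzg in gq.
  have [r fzr] : exists r, f z = r%:E.
    by move: gq (fNy z); case: (f z) => // r _ _; exists r.
  apply/(subdiff_conjugate ip (R z - z) fzr); rewrite -/(shiftS R z) -/S Szd -/(fs d) fsd.
  have := ip_shift norm_ip R_isometry z; have := ip_shift norm_ip R_isometry e.
  by move: gq; rewrite -/S -/(S z) Szd -dSe fzr !lee_fin; lra.
Qed.
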